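(* Fix $k,l<\omega$. (i) Suppose $\epsilon_0\geqslant\ldots\geqslant\epsilon_l$, $P$ is a tree with $\mathrm{rank}(P)=\omega^{\omega^{\epsilon_0}}\cdot\ldots\cdot\omega^{\omega^{\epsilon_l}}$, and $f:\Lambda_2(P)\to k+1$ is a function. Suppose $Q\subset P$ and $F:l+1\to k+1$ satisfy $\mathrm{rank}(Q)=\mathrm{rank}(P)$ and, for every $(s,t)\in\Lambda_2(Q)$, $\varsigma_Q(s,t)=\varsigma_P(s,t)$ and $F(\varsigma_Q(s,t))=f(s,t)$. Let $j\leqslant k$, $A=\{i\leqslant l: F(i)=j\}$ and $\alpha=\omega^{\omega^{\epsilon_0}\cdot 1_A(0)}\cdot\ldots\cdot\omega^{\omega^{\epsilon_l}\cdot 1_A(l)}$, where $\alpha=1$ if $A=\varnothing$. Then there exists a subtree $R$ of $P$ with $\mathrm{rank}(R)=\alpha$ such that $f|_{\Lambda_2(R)}\equiv j$. (ii) Let $F:l+1\to k+1$ be a function, fix $\epsilon_0\geqslant\ldots\geqslant\epsilon_l$ and a tree $P$ with $\mathrm{rank}(P)=\omega^{\omega^{\epsilon_0}}\cdot\ldots\cdot\omega^{\omega^{\epsilon_l}}$, and define $f:\Lambda_2(P)\to k+1$ by $f(s,t)=F(\varsigma_P(s,t))$. If $j\leqslant k$, $A=\{i\leqslant l:F(i)=j\}$, $\alpha=\omega^{\omega^{\epsilon_0}\cdot 1_A(0)}\cdot\ldots\cdot\omega^{\omega^{\epsilon_l}\cdot 1_A(l)}$ (with $\alpha=1$ if $A=\varnothing$),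 and $Q$ is any subtree of $P$ with $f|_{\Lambda_2(Q)}\equiv j$, then $\mathrm{rank}(Q)\leqslant\alpha$.
   Context: A tree is a partially ordered set $(P,\leqslant)$ such that for every $t\in P$ the set $\{s\in P: s\leqslant t\}$ is well-ordered; every subset (subtree) carries the induced order. $\mathrm{Leaves}(P)$ is the set of maximal elements. $P'=P\setminus\mathrm{Leaves}(P)$; $P^0=P$, $P^{\xi+1}=(P^\xi)'$, $P^\xi=\bigcap_{\zeta<\xi}P^\zeta$ for limit $\xi$. For well-founded $P$ (i.e. $P^\xi=\varnothing$ for some $\xi$), $\mathrm{rank}(P)=\min\{\xi:P^\xi=\varnothing\}$, and for $t\in P$, $\beta>0$, $\tau_{P,\beta}(t)=\max\{\xi:t\in P^{\beta\cdot\xi}\}$. $\Lambda_2(P)=\{(s,t)\in P\times P: s<t\}$. $1_A$ is the indicator function of $A$; $m$ is identified with $\{0,\ldots,m-1\}$. Separation: for $\gamma=\omega^{\omega^{\epsilon_0}}\cdot\ldots\cdot\omega^{\omega^{\epsilon_l}}$ with $\epsilon_0\geqslant\ldots\geqslant\epsilon_l$ (unique representation of an additively indecomposable $\gamma>1$), $\lambda(\gamma)=l+1$, $\lambda(1)=0$, $\alpha_i=\omega^{\omega^{\epsilon_0}}\cdot\ldots\cdot\omega^{\omega^{\epsilon_i}}$; for a tree $P$ of rank $\gamma$, $\varsigma_P(s,t)=\min\{i\leqslant l:\tau_{P,\alpha_i}(s)=\tau_{P,\alpha_i}(t)\}$ for $(s,t)\in\Lambda_2(P)$. If $\mathrm{rank}(P)=1$,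 $\varsigma_P$ is the empty function. *)

(* Defs.v *)
From HB Require Import structures.
From mathcomp Require Import all_boot all_order.
From mathcomp Require Import boolp classical_sets wochoice.

Set Implicit Arguments.
Unset Strict Implicit.
Unset Printing Implicit Defensive.

Import Order.TTheory.

Local Open Scope classical_set_scope.
Local Open Scope order_scope.
Local Open Scope quotient_scope.

(* Ordinals are Aczel codes modulo equality of ranks: [Sup f] codes the least
   ordinal strictly above all the [f x]. *)
Inductive code : Type := Sup (X : Type) of X -> code.

Fixpoint code_le (a b : code) {struct a} : Prop :=
  match a, b with
  | Sup X f, Sup Y g => forall x : X, exists y : Y, code_le (f x) (g y)
  end.

Definition code_lt (a b : code) : Prop :=
  match b with Sup Y g => exists y : Y, code_le a (g y) end.

Lemma code_leE (X : Type) (f : X -> code) b :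
  code_le (Sup f) b <-> forall x, code_lt (f x) b.
Proof. by case: b => Y g; split. Qed.

Lemma code_le_refl a : code_le a a.
Proof. by elim: a => X f IH x; exists x; apply: IH. Qed.

Lemma code_lt_le_trans_aux b :
  (forall a c, code_le a b -> code_le b c -> code_le a c) /\
  (forall a c, code_lt a b -> code_le b c -> code_lt a c).
Proof.
elim: b => Y g IH.
have lt_le a c : code_lt a (Sup g) -> code_le (Sup g) c -> code_lt a c.
  case: c => Z h [y ay] /(_ y)[z yz]; exists z.
  by have [le_trans _] := IH y; apply: le_trans ay yz.
split=> // a c; case: a => X f /code_leE ab bc; apply/code_leE => x.
exact: lt_le (ab x) bc.
Qed.

Lemma code_le_trans b a c : code_le a b -> code_le b c -> code_le a c.
Proof. by have [+ _] := code_lt_le_trans_aux b; apply. Qed.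

Lemma code_lt_le_trans b a c : code_lt a b -> code_le b c -> code_lt a c.
Proof. by have [_ +] := code_lt_le_trans_aux b; apply. Qed.

Lemma code_ltW a b : code_lt a b -> code_le a b.
Proof.
elim: b a => Y g IH a [y ay]; case: a ay => X f /code_leE ay.
by apply/code_leE => x; exists y; apply: IH; apply: ay.
Qed.

Lemma code_le_lt_trans b a c : code_le a b -> code_lt b c -> code_lt a c.
Proof. by case: c => Z h ab [z bz]; exists z; apply: code_le_trans ab bz. Qed.

Lemma code_le_or_lt a b : code_le a b \/ code_lt b a.
Proof.
elim: a b => X f IH b.
have [[x bx]|nbx] := pselect (exists x, code_le b (f x)); first by right; exists x.
left; apply/code_leE => x; elim: b nbx => Y g IHb nbx.
have [[y xy]|nxy] := pselect (exists y, code_le (f x) (g y)); first by exists y.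
exfalso; apply: nbx; exists x; apply/code_leE => y.
by have [xy|//] := IH x (g y); case: nxy; exists y.
Qed.

Lemma code_lt_irr a : ~ code_lt a a.
Proof.
elim: a => X f IH [x] /code_leE /(_ x); exact: IH.
Qed.

HB.instance Definition _ := gen_eqMixin code.
HB.instance Definition _ := gen_choiceMixin code.

Definition code_eqv : rel code := fun a b => `[< code_le a b /\ code_le b a >].

Lemma code_eqv_refl : reflexive code_eqv.
Proof. by move=> a; apply/asboolP; split; apply: code_le_refl. Qed.

Lemma code_eqv_sym : symmetric code_eqv.
Proof. by move=> a b; apply/asboolP/asboolP => -[]. Qed.

Lemma code_eqv_trans : transitive code_eqv.
Proof.
move=> b a c /asboolP[ab ba] /asboolP[bc cb]; apply/asboolP.
by split; [apply: code_le_trans ab bc | apply: code_le_trans cb ba].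
Qed.

Canonical code_equiv : equiv_rel code :=
  EquivRel code_eqv code_eqv_refl code_eqv_sym code_eqv_trans.

Definition Ord : Type := {eq_quot code_equiv}.
HB.instance Definition _ := Choice.on Ord.
HB.instance Definition _ := EqQuotient.on Ord.

Fact Ord_display : Order.disp_t. Proof. exact: (Order.Disp tt tt). Qed.

Definition Ord_le : rel Ord := fun a b => `[< code_le (repr a) (repr b) >].

Lemma Ord_le_refl : reflexive Ord_le.
Proof. by move=> a; apply/asboolP/code_le_refl. Qed.

Lemma Ord_le_anti : antisymmetric Ord_le.
Proof.
move=> a b /andP[/asboolP ab /asboolP ba].
rewrite -[a]reprK -[b]reprK; apply/eqmodP; exact/asboolP.
Qed.

Lemma Ord_le_trans : transitive Ord_le.
Proof.
by move=> b a c /asboolP ab /asboolP bc; apply/asboolP/(code_le_trans ab bc).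
Qed.

HB.instance Definition _ :=
  Order.Le_isPOrder.Build Ord_display Ord Ord_le_refl Ord_le_anti Ord_le_trans.

Lemma Ord_le_total : total (<=%O : rel Ord).
Proof.
move=> a b; have [ab|/code_ltW ba] := code_le_or_lt (repr a) (repr b).
  by apply/orP; left; apply/asboolP.
by apply/orP; right; apply/asboolP.
Qed.

HB.instance Definition _ := Order.POrder_isTotal.Build Ord_display Ord Ord_le_total.

Implicit Types a b c : Ord.

Lemma Ord_leE a b : a <= b <-> code_le (repr a) (repr b).
Proof. by split=> /asboolP. Qed.

Lemma code_ltNle x y : code_lt x y <-> ~ code_le y x.
Proof.
split=> [xy yx|]; first exact: code_lt_irr (code_lt_le_trans xy yx).
by have [|] := code_le_or_lt y x.
Qed.

Lemma Ord_ltE a b : a < b <-> code_lt (repr a) (repr b).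
Proof.
rewrite ltNge code_ltNle; split=> [/negP ba /Ord_leE//|ba].
by apply/negP => /Ord_leE.
Qed.

Lemma repr_pi_le (x : code) :
  code_le (repr (\pi_Ord x)) x /\ code_le x (repr (\pi_Ord x)).
Proof.
have /eqmodP/asboolP[//] : repr (\pi_Ord x) = x %[mod {eq_quot code_equiv}].
exact: reprK.
Qed.

Lemma pi_Sup_le (X : Type) (f : X -> code) b :
  \pi_Ord (Sup f) <= b <-> forall x, \pi_Ord (f x) < b.
Proof.
have [le_f ge_f] := repr_pi_le (Sup f); rewrite Ord_leE; split.
  move=> /(code_le_trans ge_f)/code_leE fb x; apply/Ord_ltE.
  exact: code_le_lt_trans (repr_pi_le (f x)).1 (fb x).
move=> fb; apply: code_le_trans le_f _; apply/code_leE => x.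
by apply: code_le_lt_trans (repr_pi_le (f x)).2 _; apply/Ord_ltE.
Qed.

Lemma Ord_wf : well_founded (<%O : rel Ord).
Proof.
have code_wf : well_founded code_lt.
  elim=> X f IH; constructor=> b [x bx].
  constructor=> c cb; apply: (Acc_inv (IH x)).
  exact: code_lt_le_trans cb bx.
move=> a; have [x ax] : exists x, repr a = x by exists (repr a).
elim/(well_founded_ind code_wf): x a ax => x IH a ax; constructor=> b /Ord_ltE ba.
by apply: (IH (repr b)) => //; rewrite -ax.
Qed.

Lemma Ord_min (S : set Ord) : S !=set0 -> exists a, (S `&` lbound S) a.
Proof.
case=> a; elim/(well_founded_ind Ord_wf): a => a IH Sa.
have [[b [Sb ba]]|nS] := pselect (exists b, S b /\ b < a); first exact: IH Sb.
exists a; split=> // b Sb; rewrite leNgt; apply/negP => ba.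
by apply: nS; exists b.
Qed.

(* [omin] and [omax] default to 0 when there is no minimum (maximum), and
   [osup] when the set is unbounded. *)
Definition ozero : Ord := \pi_Ord (Sup (fun x : False => match x with end)).
Definition omin (S : set Ord) : Ord := xget ozero (S `&` lbound S).
Definition omax (S : set Ord) : Ord := xget ozero (S `&` ubound S).
Definition osup (S : set Ord) : Ord := supremum ozero S.

Lemma ominP (S : set Ord) : S !=set0 -> S (omin S) /\ lbound S (omin S).
Proof. by move=> /Ord_min[a Sa]; rewrite /omin; case: xgetP => // /(_ a). Qed.

Lemma omaxP (S : set Ord) a : S a -> ubound S a -> omax S = a.
Proof.
move=> Sa ua; rewrite /omax; case: xgetP => [b _ [Sb ub]|/(_ a)[]//].
by apply/le_anti; rewrite ua// ub.
Qed.

Lemma ozero_le a : ozero <= a.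
Proof. by apply/pi_Sup_le. Qed.

Lemma osupP (S : set Ord) b : ubound S b -> isLub S (osup S).
Proof.
move=> Sb; rewrite /osup /supremum; case: eqP => [->|/eqP S0].
  by split=> [x|c _] //; apply: ozero_le.
have [m [Sm lm]] : exists m, (ubound S `&` lbound (ubound S)) m.
  by apply: Ord_min; exists b.
by case: xgetP => [c _ [Sc lc]|/(_ m)[]//]; split.
Qed.

Definition osucc a : Ord := \pi_Ord (Sup (fun _ : unit => repr a)).

Lemma osucc_le a b : (osucc a <= b) = (a < b).
Proof.
apply/idP/idP => [/pi_Sup_le /(_ tt)|ab]; first by rewrite reprK.
by apply/pi_Sup_le => _; rewrite reprK.
Qed.

Lemma lt_osucc a b : (a < osucc b) = (a <= b).
Proof. by rewrite ltNge osucc_le -leNgt. Qed.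

Lemma osucc_inj : injective osucc.
Proof.
move=> a b ab; apply/le_anti/andP; split.
  by rewrite -lt_osucc -ab lt_osucc.
by rewrite -lt_osucc ab lt_osucc.
Qed.

Lemma osucc_neq0 a : osucc a <> ozero.
Proof. by move=> a0; have := ozero_le a; rewrite -a0 osucc_le ltxx. Qed.

Definition is_limit a := a <> ozero /\ forall b, a <> osucc b.

Section TransfiniteRecursion.
Variables (A : Type) (z : A) (s : A -> A) (L : set A -> A).

Let step a (rec : forall b, b < a -> A) : A :=
  if a == ozero then z else
  match pselect (exists y, exists b (ba : b < a),
                   a = osucc b /\ y = s (rec b ba)) with
  | left ex_y => sval (cid ex_y)
  | right _ => L [set y | exists b (ba : b < a), y = rec b ba]
  end.

Definition transrec : Ord -> A := Fix Ord_wf (fun _ => A) step.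

Let transrecE a : transrec a = step (fun b (_ : b < a) => transrec b).
Proof.
apply: (Fix_eq Ord_wf (fun _ => A)) => x f g fg.
suff -> : f = g by [].
apply: functional_extensionality_dep => b.
by apply: functional_extensionality_dep => h; apply: fg.
Qed.

Lemma transrec0 : transrec ozero = z.
Proof. by rewrite transrecE /step eqxx. Qed.

Lemma transrecS a : transrec (osucc a) = s (transrec a).
Proof.
rewrite transrecE /step; case: eqP => [/osucc_neq0//|_].
case: pselect => [ex_y|[]]; last first.
  have aS : a < osucc a by rewrite lt_osucc.
  by exists (s (transrec a)), a, aS.
by case: cid => y /= [b [_ [/osucc_inj <- ->]]].
Qed.

Lemma transrec_limit a : is_limit a ->
  transrec a = L [set transrec b | b in [set b | b < a]].
Proof.
case=> a0 aS; rewrite transrecE /step; case: eqP => // _.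
case: pselect => [[y [b [_ [/aS]]]]//|_]; congr L.
apply/seteqP; split=> [y [b [ba ->]]|y [b ba <-]]; first by exists b.
by exists b, ba.
Qed.

End TransfiniteRecursion.

Definition oone : Ord := osucc ozero.
Definition omega : Ord := omin is_limit.
Definition oadd a b : Ord := transrec a osucc osup b.
Definition omul a b : Ord := transrec ozero (oadd^~ a) osup b.
Definition oexp a b : Ord := transrec oone (omul^~ a) osup b.

Declare Scope ord_scope.
Delimit Scope ord_scope with ord.
Bind Scope ord_scope with Ord.
Notation "0" := ozero : ord_scope.
Notation "1" := oone : ord_scope.
Notation "a + b" := (oadd a b) : ord_scope.
Notation "a * b" := (omul a b) : ord_scope.
Notation "a ^ b" := (oexp a b) : ord_scope.

Fixpoint subcodes (x : code) : Type :=
  match x with Sup X f => {i : X & option (subcodes (f i))} end.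

Fixpoint subcode (x : code) : subcodes x -> code :=
  match x with
  | Sup X f => fun i =>
      match i with
      | existT i None => f i
      | existT i (Some j) => subcode j
      end
  end.

(* The ordinals below a given one form a set, hence every set-indexed family
   is bounded (replacement). *)
Lemma lt_small a :
  exists (X : Type) (g : X -> Ord), forall b, b < a -> exists i, b = g i.
Proof.
exists (subcodes (repr a)), (fun i => \pi_Ord (subcode i)) => b.
rewrite -{1}[a]reprK; elim: (repr a) b => X f IH b.
have [bf|/negP bf] := boolP `[< exists i, b <= \pi_Ord (f i) >].
  move=> _; have /asboolP[i] := bf; rewrite le_eqVlt => /predU1P[->|/IH[j ->]].
    by exists (existT _ i None).
  by exists (existT _ i (Some j)).
rewrite ltNge => /negP[]; apply/pi_Sup_le => i; rewrite ltNge.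
by apply/negP => bi; apply/bf/asboolP; exists i.
Qed.

Lemma image_lt_bounded (F : Ord -> Ord) a :
  exists u, ubound [set F b | b in [set b | b < a]] u.
Proof.
have [X [g aE]] := lt_small a.
exists (\pi_Ord (Sup (fun i => repr (F (g i))))) => _ [b /aE[i ->] <-].
set u := \pi_Ord _; apply/ltW.
by have /pi_Sup_le/(_ i) := lexx u; rewrite reprK.
Qed.

Variant Ord_spec : Ord -> Type :=
  | OrdZero : Ord_spec ozero
  | OrdSucc a : Ord_spec (osucc a)
  | OrdLimit a of is_limit a : Ord_spec a.

Lemma OrdP a : Ord_spec a.
Proof.
have [->|/eqP a0] := eqVneq a ozero; first exact: OrdZero.
have [/cid[b ->]|aS] := pselect (exists b, a = osucc b); first exact: OrdSucc.
by apply: OrdLimit; split=> // b ab; apply: aS; exists b.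
Qed.

Lemma lt_limit a b : is_limit a -> b < a -> osucc b < a.
Proof.
by case=> _ aS; rewrite -osucc_le le_eqVlt => /predU1P[/esym/aS//|].
Qed.

Lemma osup_limit (F : Ord -> Ord) a :
  isLub [set F b | b in [set b | b < a]] (osup [set F b | b in [set b | b < a]]).
Proof. by have [u /osupP] := image_lt_bounded F a. Qed.

Lemma transrec_lt z s : (forall x, x < s x) ->
  {homo transrec z s osup : a b / a < b}.
Proof.
move=> s_gt a b; elim/(well_founded_ind Ord_wf): b => b.
case: (OrdP b) => [|{}b|{}b lim_b] IH ab.
- by move: ab; rewrite ltNge ozero_le.
- rewrite transrecS; apply: le_lt_trans (s_gt _).
  move: ab; rewrite lt_osucc le_eqVlt => /predU1P[->//|ab].
  by apply/ltW/IH => //; rewrite lt_osucc.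
- have sab := lt_limit lim_b ab; rewrite (transrec_limit _ _ _ lim_b).
  apply: (@lt_le_trans _ _ (transrec z s osup (osucc a))).
    by rewrite transrecS.
  by apply: (osup_limit (transrec z s osup) b).1; exists (osucc a).
Qed.

Lemma omega_limit : is_limit omega.
Proof.
suff [a lim_a] : is_limit !=set0 by have [] := ominP (ex_intro _ a lim_a).
pose w := \pi_Ord (Sup (fun n => repr (iter n osucc ozero))).
have lt_w n : iter n osucc ozero < w.
  by have /pi_Sup_le/(_ n) := lexx w; rewrite reprK.
exists w; split=> [w0|b wb]; first by have := lt_w 0; rewrite w0 ltxx.
have : b < w by rewrite wb lt_osucc.
rewrite ltNge => /negP[]; apply/pi_Sup_le => n; rewrite reprK.
by have := lt_w n.+1; rewrite wb lt_osucc /= osucc_le.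
Qed.

Lemma lt_omegaP a : a < omega <-> exists n, a = iter n osucc ozero.
Proof.
split=> [|[n ->]]; last first.
  elim: n => [|n IH]; last exact: lt_limit omega_limit IH.
  by rewrite lt_neqAle ozero_le andbT; apply/eqP => /esym; have [] := omega_limit.
elim/(well_founded_ind Ord_wf): a => a.
case: (OrdP a) => [|{}a|{}a lim_a] IH a_lt; first by exists 0.
  have a_succ : a < osucc a by rewrite lt_osucc.
  by have [n ->] := IH a a_succ (lt_trans a_succ a_lt); exists n.+1.
have [_ /(_ a lim_a)] := ominP (ex_intro _ omega omega_limit).
by rewrite leNgt a_lt.
Qed.

Lemma oadd_gt a b : ozero < b -> a < oadd a b.
Proof.
move=> b0; rewrite -[ltLHS](transrec0 a osucc osup).
by apply: transrec_lt b0 => x; rewrite lt_osucc.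
Qed.

Lemma omul_lt b : ozero < b -> {homo omul b : x y / x < y}.
Proof. by move=> b0; apply: transrec_lt => x; apply: oadd_gt. Qed.

(* Ordinal multiplication is not commutative: these products are taken with
   the index increasing from left to right. *)
Definition gamma (l : nat) (eps : 'I_l.+1 -> Ord) : Ord :=
  \big[omul/oone]_(m < l.+1) (omega ^ (omega ^ eps m))%ord.

Definition gamma_upto (l : nat) (eps : 'I_l.+1 -> Ord) (i : 'I_l.+1) : Ord :=
  \big[omul/oone]_(m < l.+1 | (m <= i)%N) (omega ^ (omega ^ eps m))%ord.

Definition oindic (I : finType) (A : {set I}) (i : I) : Ord :=
  if i \in A then oone else ozero.

Definition gamma_on (l : nat) (eps : 'I_l.+1 -> Ord) (A : {set 'I_l.+1}) : Ord :=
  \big[omul/oone]_(m < l.+1) (omega ^ (omega ^ eps m * oindic A m))%ord.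

Lemma gamma_on0 (l : nat) (eps : 'I_l.+1 -> Ord) : gamma_on eps finset.set0 = oone.
Proof.
rewrite /gamma_on; elim/big_ind: _ => // [_ _ -> ->|m _].
  by rewrite /omul transrecS transrec0 /oadd transrecS transrec0.
by rewrite /oindic finset.in_set0 /omul transrec0 /oexp transrec0.
Qed.

Section Trees.
Variables (d : Order.disp_t) (T : porderType d).
Implicit Types (P Q : set T) (s t : T).

Definition is_tree P : Prop :=
  forall t, P t -> wo_chain (<=%O : rel T) [in [set s | P s /\ s <= t]].

Definition leaves P : set T := [set t | P t /\ forall s, P s -> ~ t < s].

Definition tderiv1 P : set T := P `\` leaves P.

Definition tderiv P (a : Ord) : set T :=
  transrec P tderiv1 (fun F => \bigcap_(A in F) A) a.

Definition wf_tree P : Prop := exists a, tderiv P a = set0.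

Definition rank P : Ord := omin [set a | tderiv P a = set0].

Definition tau P (b : Ord) t : Ord := omax [set a | tderiv P (omul b a) t].

Definition Lambda2 P : set (T * T) :=
  [set st | [/\ P st.1, P st.2 & st.1 < st.2]].

(* [sep eps P] is the separation function of a well-founded tree P of rank
   [gamma eps]; the sequence [eps] is an argument although it is determined by
   the rank of P.  For i = ord_max both values of [tau] are then 0, so the
   default [ord_max] of the minimum does satisfy the condition. *)
Definition sep (l : nat) (eps : 'I_l.+1 -> Ord) P (st : T * T) : 'I_l.+1 :=
  [arg min_(i < ord_max | `[< tau P (gamma_upto eps i) st.1 =
                              tau P (gamma_upto eps i) st.2 >]) i]%N.

Lemma is_tree_sub P Q : Q `<=` P -> is_tree P -> is_tree Q.
Proof.
move=> QP treeP t /QP/treeP wo A AQ; apply: wo => x /AQ.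
by rewrite !inE => -[/QP].
Qed.

Lemma tderiv1_sub P : tderiv1 P `<=` P.
Proof. by move=> t []. Qed.

Lemma tderiv1S P Q : Q `<=` P -> tderiv1 Q `<=` tderiv1 P.
Proof.
move=> QP t [Qt nleaf]; split; first exact: QP.
by move=> [_ max_t]; apply: nleaf; split=> // s /QP/max_t.
Qed.

Lemma tderivS P Q a : Q `<=` P -> tderiv Q a `<=` tderiv P a.
Proof.
move=> QP; elim/(well_founded_ind Ord_wf): a => a.
case: (OrdP a) => [|{}a|{}a lim_a] IH.
- by rewrite /tderiv !transrec0.
- by rewrite /tderiv !transrecS; apply/tderiv1S/IH; rewrite lt_osucc.
- rewrite /tderiv !transrec_limit// => t Qt _ [b ba <-].
  by apply: (IH b ba); apply: Qt; exists b.
Qed.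

Lemma wf_tree_sub P Q : Q `<=` P -> wf_tree P -> wf_tree Q.
Proof.
by move=> QP [a Pa]; exists a; rewrite -subset0 -Pa; apply: tderivS.
Qed.

Lemma tderiv_anti P a b : a <= b -> tderiv P b `<=` tderiv P a.
Proof.
rewrite le_eqVlt => /predU1P[->//|]; elim/(well_founded_ind Ord_wf): b => b.
case: (OrdP b) => [|{}b|{}b lim_b] IH ab.
- by move: ab; rewrite ltNge ozero_le.
- rewrite {1}/tderiv transrecS => t /tderiv1_sub.
  move: ab; rewrite lt_osucc le_eqVlt => /predU1P[->//|ab].
  by apply: IH; rewrite ?lt_osucc.
- by rewrite {1}/tderiv transrec_limit// => t; apply; exists a.
Qed.

Lemma rankP P : wf_tree P ->
  tderiv P (rank P) = set0 /\ forall a, tderiv P a = set0 -> rank P <= a.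
Proof. by move=> /ominP. Qed.

Lemma tauP P b t : wf_tree P -> ozero < b -> P t ->
  tderiv P (omul b (tau P b t)) t /\
  forall a, tderiv P (omul b a) t -> a <= tau P b t.
Proof.
move=> [r Pr] b0 Pt; set S := [set a | tderiv P (omul b a) t].
have le_mul a : a <= omul b a.
  elim/(well_founded_ind Ord_wf): a => a IH; rewrite leNgt; apply/negP => ba.
  by have := IH _ ba; rewrite leNgt (omul_lt b0 ba).
have [|c [nSc min_c]] := @Ord_min (~` S).
  exists r => /(tderiv_anti (le_mul r)); rewrite Pr; exact.
have below a : a < c -> S a.
  by rewrite ltNge => /negP ac; apply: contrapT => /min_c.
have above a : S a -> a < c.
  move=> Sa; rewrite ltNge; apply/negP => ca; apply: nSc.
  apply: tderiv_anti Sa; move: ca; rewrite le_eqVlt => /predU1P[->//|].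
  by move=> /(omul_lt b0)/ltW.
clear min_c; case: (OrdP c) nSc below above => [|{}c|{}c lim_c] nSc below above.
- by case: nSc; rewrite /S/= /omul transrec0 /tderiv transrec0.
- have <- : c = tau P b t.
    by apply/esym/omaxP => [|a /above]; [apply: below|]; rewrite lt_osucc.
  by split=> [|a /above]; [apply: below|]; rewrite lt_osucc.
- case: nSc; rewrite /S/=.
  have lubE := osup_limit (omul b) c.
  have mulE : omul b c = _ := transrec_limit _ _ _ lim_c.
  have lt_mul a : a < omul b c -> exists2 x, x < c & a < omul b x.
    move=> ac; apply: contrapT => nx; move: ac; rewrite ltNge => /negP[].
    rewrite mulE; apply: lubE.2 => _ [x xc <-]; rewrite leNgt.
    by apply/negP => ax; apply: nx; exists x.
  have lim_bc : is_limit (omul b c).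
    split=> [bc0|a bca].
      have c0 : ozero < c.
        by rewrite lt_neqAle ozero_le andbT; apply/eqP => /esym; case: lim_c.
      by have := omul_lt b0 c0; rewrite bc0 ltNge ozero_le.
    have [|x xc ax] := lt_mul a; first by rewrite bca lt_osucc.
    have := omul_lt b0 xc; rewrite bca lt_osucc leNgt; exact/negP/negPn.
  rewrite /tderiv transrec_limit// => _ [a /lt_mul[x xc ax] <-].
  exact: tderiv_anti (ltW ax) _ (below _ xc).
Qed.

End Trees.

(* Main.v *)
Require Import Defs.
From mathcomp Require Import all_boot all_order.
From mathcomp Require Import boolp classical_sets.

Import Order.TTheory.

Local Open Scope classical_set_scope.
Local Open Scope order_scope.

(* The height h t of t in P (the largest xi with t in P^xi) satisfies: h is
   strictly decreasing, and every ordinal below h t is the height of some point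
   above t.  The function tau_{P,b} is the quotient of h by b, so for P of rank
   gamma the separation function is the position of the most significant digit
   at which the heights of s and t differ, in the mixed radix system with radices
   omega^(omega^eps_i).

   Deleting the digits outside A maps ordinals below gamma to ordinals below
   alpha, and decreases strictly along pairs separated in A; this bounds the rank
   in (ii).  Inserting zero digits outside A embeds alpha in gamma; the points
   whose heights are in the image of this embedding form the set R of (i).  The
   paper's hypothesis on Q makes it enough to find R inside Q, using the heights
   and the separation function of Q. *)

(** * Normal functions on the ordinals *)

(** Continuity at limits is stated as an upper bound only; the reverse inequality follows from
    monotonicity. *)
Definition normal (g : Ord -> Ord) : Prop :=
  {homo g : a b / a < b} /\
  forall c u, is_limit c -> (forall b, b < c -> g b <= u) -> g c <= u.

Lemma ozero_lt_limit c : is_limit c -> ozero < c.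
Proof.
by move=> [c0 _]; rewrite lt_neqAle ozero_le andbT; apply/eqP => /esym.
Qed.

Lemma normal_mono g : normal g -> {mono g : a b / a <= b}.
Proof. by move=> [g_lt _]; apply: le_mono. Qed.

Lemma normal_lt_mono g : normal g -> {mono g : a b / a < b}.
Proof. by move=> /normal_mono; apply: leW_mono. Qed.

Lemma normal_ge g a : normal g -> a <= g a.
Proof.
move=> [g_lt _]; elim/(well_founded_ind Ord_wf): a => a IH.
rewrite leNgt; apply/negP => ga.
by have := IH _ ga; rewrite leNgt g_lt.
Qed.

Lemma normal_lt_limit {g c} d : normal g -> is_limit c -> d < g c ->
  exists2 b, b < c & d < g b.
Proof.
move=> [_ g_lim] lim_c; rewrite ltNge => /negP dgc; apply: contrapT => nb.
apply: dgc; apply: (g_lim _ _ lim_c) => b bc; rewrite leNgt.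
by apply/negP => db; apply: nb; exists b.
Qed.

Lemma normal_limit g c : normal g -> is_limit c -> is_limit (g c).
Proof.
move=> ng lim_c; split=> [gc0|d gcd].
  have := normal_lt_mono _ ng ozero c; rewrite (ozero_lt_limit _ lim_c) gc0.
  by rewrite ltNge ozero_le.
have [|b bc] := normal_lt_limit d ng lim_c; first by rewrite gcd lt_osucc.
by rewrite -osucc_le -gcd (normal_mono _ ng) leNgt bc.
Qed.

Lemma normal_comp g h : normal g -> normal h -> normal (g \o h).
Proof.
move=> ng nh; split=> [a b ab|c u lim_c gu] /=.
  by rewrite (normal_lt_mono _ ng) (normal_lt_mono _ nh).
apply: ng.2 (normal_limit _ _ nh lim_c) _ => d dhc.
have [b bc db] := normal_lt_limit d nh lim_c dhc.
apply: le_trans (gu b bc); rewrite /= (normal_mono _ ng); exact: ltW.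
Qed.

Lemma normal_id : normal id.
Proof.
split=> // c u lim_c cu; rewrite leNgt; apply/negP => uc.
have := cu _ (lt_limit lim_c uc); by rewrite osucc_le ltxx.
Qed.

Lemma normal_transrec z s : (forall x, x < s x) -> normal (transrec z s osup).
Proof.
move=> s_gt; split=> [|c u lim_c cu]; first exact: transrec_lt.
rewrite (transrec_limit _ _ _ lim_c).
by apply: (osup_limit (transrec z s osup) c).2 => _ [b bc <-]; apply: cu.
Qed.

(** Uniqueness of normal solutions of a recursion. It yields the laws of ordinal arithmetic below
    without a limit case in each. *)
Lemma normal_eq g h (s : Ord -> Ord) : normal g -> normal h ->
  g ozero = h ozero -> (forall a, g (osucc a) = s (g a)) ->
  (forall a, h (osucc a) = s (h a)) -> g =1 h.
Proof.
move=> ng nh gh0 gS hS; elim/(well_founded_ind Ord_wf) => a.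
case: (OrdP a) => [|{}a|{}a lim_a] IH //.
  by rewrite gS hS IH// lt_osucc.
apply/le_anti/andP; split.
  by apply: ng.2 => // b ba; rewrite IH//; apply/ltW/nh.1.
by apply: nh.2 => // b ba; rewrite -IH//; apply/ltW/ng.1.
Qed.

(** The least [c] with [r < g c] is not 0, and by continuity not a limit, so it is the successor of
    the required [q]. *)
Lemma normal_bracket g r : normal g -> g ozero <= r ->
  exists q, g q <= r < g (osucc q).
Proof.
move=> ng g0r.
have [|c [/= rc cmin]] := @Ord_min [set c | r < g c].
  exists (osucc r) => /=; apply: lt_le_trans (normal_ge _ _ ng).
  by rewrite lt_osucc.
have below b : b < c -> g b <= r.
  by move=> bc; rewrite leNgt; apply/negP => /cmin; rewrite leNgt bc.
case: (OrdP c) rc below {cmin} => [|{}c|{}c lim_c] rc below.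
- by move: rc; rewrite ltNge g0r.
- by exists c; rewrite rc below ?lt_osucc.
- by move: rc; rewrite ltNge (ng.2 _ _ lim_c below).
Qed.

(** * Laws of ordinal addition and multiplication *)

Lemma oadd0 a : oadd a ozero = a.
Proof. exact: transrec0. Qed.

Lemma oaddS a b : oadd a (osucc b) = osucc (oadd a b).
Proof. exact: transrecS. Qed.

Lemma omul0 a : omul a ozero = ozero.
Proof. exact: transrec0. Qed.

Lemma omulS a b : omul a (osucc b) = oadd (omul a b) a.
Proof. exact: transrecS. Qed.

Lemma normal_oadd a : normal (oadd a).
Proof. by apply: normal_transrec => x; rewrite lt_osucc. Qed.

Lemma normal_omul a : ozero < a -> normal (omul a).
Proof. by move=> a0; apply: normal_transrec => x; apply: oadd_gt. Qed.

Lemma add0o : left_id ozero oadd.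
Proof.
apply: (normal_eq _ id osucc (normal_oadd _) normal_id) (oaddS _) _ => //.
exact: oadd0.
Qed.

Lemma oaddA : associative oadd.
Proof.
move=> a b; apply: (normal_eq (oadd a \o oadd b) _ osucc) => [|||c|c] /=.
- exact: normal_comp (normal_oadd a) (normal_oadd b).
- exact: normal_oadd.
- by rewrite !oadd0.
- by rewrite !oaddS.
- exact: oaddS.
Qed.

Lemma omul1 : right_id oone omul.
Proof. by move=> a; rewrite /oone omulS omul0 add0o. Qed.

Lemma oone_gt0 : ozero < oone.
Proof. by rewrite lt_osucc. Qed.

Lemma mul1o : left_id oone omul.
Proof.
apply: (normal_eq _ id (oadd^~ oone)) normal_id _ (omulS _) _.
- exact: normal_omul oone_gt0.
- exact: omul0.
- by move=> a; rewrite /oone oaddS oadd0.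
Qed.

Lemma omulDr x a b : ozero < x -> omul x (oadd a b) = oadd (omul x a) (omul x b).
Proof.
move=> x0; apply: (normal_eq (omul x \o oadd a) (oadd (omul x a) \o omul x)
  (fun y => oadd y x)) => [|||c|c] /=.
- exact: normal_comp (normal_omul _ x0) (normal_oadd _).
- exact: normal_comp (normal_oadd _) (normal_omul _ x0).
- by rewrite omul0 !oadd0.
- by rewrite oaddS omulS.
- by rewrite omulS oaddA.
Qed.

Lemma omul_gt0 a b : ozero < a -> ozero < b -> ozero < omul a b.
Proof. by move=> a0 b0; rewrite -(omul0 a) omul_lt. Qed.

Lemma omulA x a b : ozero < x -> ozero < a ->
  omul x (omul a b) = omul (omul x a) b.
Proof.
move=> x0 a0; apply: (normal_eq (omul x \o omul a) (omul (omul x a))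
  (fun y => oadd y (omul x a))) => [|||c|c] /=.
- exact: normal_comp (normal_omul _ x0) (normal_omul _ a0).
- exact: normal_omul (omul_gt0 _ _ x0 a0).
- by rewrite !omul0.
- by rewrite omulS omulDr.
- exact: omulS.
Qed.

Lemma omega_exp_gt0 a : ozero < oexp omega a.
Proof.
elim/(well_founded_ind Ord_wf): a => a; case: (OrdP a) => [|{}a|{}a lim_a] IH.
- by rewrite /oexp transrec0 lt_osucc.
- rewrite /oexp transrecS; apply: omul_gt0 (ozero_lt_limit _ omega_limit).
  by apply: IH; rewrite lt_osucc.
- rewrite /oexp (transrec_limit _ _ _ lim_a).
  apply: lt_le_trans (IH _ (ozero_lt_limit _ lim_a)) _.
  apply: (osup_limit (oexp omega) a).1; exists ozero => //.
  exact: ozero_lt_limit.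
Qed.

(** * Division with remainder *)

Definition odiv (r b : Ord) : Ord := omax [set q | omul b q <= r].

Lemma odiv_bounds r b : ozero < b ->
  omul b (odiv r b) <= r < omul b (osucc (odiv r b)).
Proof.
move=> b0; have nb := normal_omul _ b0.
have [|q qP] := normal_bracket _ r nb; first by rewrite omul0 ozero_le.
rewrite /odiv (omaxP (a := q))//; first by case/andP: qP.
move=> a /= ar; rewrite -lt_osucc -(normal_lt_mono _ nb).
by apply: le_lt_trans ar _; case/andP: qP.
Qed.

Lemma le_odiv r b a : ozero < b -> (a <= odiv r b) = (omul b a <= r).
Proof.
move=> b0; have nb := normal_omul _ b0; have /andP[qr rq] := odiv_bounds r b b0.
apply/idP/idP => [aq|ar]; first by apply: le_trans qr; rewrite (normal_mono _ nb).
by rewrite -lt_osucc -(normal_lt_mono _ nb); apply: le_lt_trans ar rq.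
Qed.

(** By the adjunction [le_odiv] and associativity, both sides have the same ordinals below them. *)
Lemma odiv_omul r x b : ozero < x -> ozero < b ->
  odiv r (omul x b) = odiv (odiv r x) b.
Proof.
move=> x0 b0.
have E a : (a <= odiv r (omul x b)) = (a <= odiv (odiv r x) b).
  by rewrite !le_odiv ?omul_gt0// omulA.
by apply/le_anti; rewrite -E lexx E lexx.
Qed.

Lemma odivD b q d : ozero < b -> d < b -> odiv (oadd (omul b q) d) b = q.
Proof.
move=> b0 db; have nb := normal_omul _ b0; apply/le_anti/andP; split.
  rewrite -lt_osucc -(normal_lt_mono _ nb).
  have /andP[+ _] := odiv_bounds (oadd (omul b q) d) b b0.
  by move/le_lt_trans; apply; rewrite omulS (normal_lt_mono _ (normal_oadd _)).
rewrite le_odiv// -[leLHS]oadd0 (normal_mono _ (normal_oadd _)); exact: ozero_le.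
Qed.

(** The remainder comes from bracketing [r] between values of the normal function that adds to [b]
    times the quotient. *)
Lemma odiv_eucl r b : ozero < b ->
  exists2 d, d < b & r = oadd (omul b (odiv r b)) d.
Proof.
move=> b0; have /andP[qr rq] := odiv_bounds r b b0.
have na := normal_oadd (omul b (odiv r b)).
have [|d /andP[dr rd]] := normal_bracket _ r na; first by rewrite oadd0.
have E : r = oadd (omul b (odiv r b)) d.
  by apply/le_anti; rewrite dr andbT -lt_osucc -oaddS.
by exists d => //; rewrite -(normal_lt_mono _ na) -E -omulS.
Qed.

Lemma odiv_lt r x b : ozero < x -> r < omul x b -> odiv r x < b.
Proof. by move=> x0; rewrite ltNge => rb; rewrite ltNge le_odiv. Qed.

Lemma odiv_le s r x : ozero < x -> s <= r -> odiv s x <= odiv r x.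
Proof.
move=> x0 sr; rewrite le_odiv//; apply: le_trans sr.
by have /andP[] := odiv_bounds s x x0.
Qed.

Lemma odiv_small r b : r < b -> odiv r b = ozero.
Proof.
move=> rb; have b0 : ozero < b by apply: le_lt_trans rb; apply: ozero_le.
by rewrite -[RHS](odivD b ozero r)// omul0 add0o.
Qed.

Lemma oadd_omul_lt x a d b : ozero < x -> d < x -> a < b ->
  oadd (omul x a) d < omul x b.
Proof.
move=> x0 dx ab; apply: (@lt_le_trans _ _ (omul x (osucc a))).
  by rewrite omulS (normal_lt_mono _ (normal_oadd _)).
by rewrite (normal_mono _ (normal_omul _ x0)) osucc_le.
Qed.

Lemma oadd_omul_lt2 x a d b d' : ozero < x -> d < x -> a < b ->
  oadd (omul x a) d < oadd (omul x b) d'.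
Proof.
move=> x0 dx ab; apply: lt_le_trans (oadd_omul_lt _ _ _ _ x0 dx ab) _.
by rewrite -[leLHS]oadd0 (normal_mono _ (normal_oadd _)) ozero_le.
Qed.

(** * Mixed radix digits, the least significant one having index 0 *)

Lemma big_ord_recl_cond (R : Type) (op : R -> R -> R) (idx : R) n
    (P : pred 'I_n.+1) (F : 'I_n.+1 -> R) :
  \big[op/idx]_(i < n.+1 | P i) F i =
  let y := \big[op/idx]_(i < n | P (lift ord0 i)) F (lift ord0 i) in
  if P ord0 then op (F ord0) y else y.
Proof.
have enumE k (Q : pred 'I_k) G :
    \big[op/idx]_(i < k | Q i) G i = \big[op/idx]_(i <- enum 'I_k | Q i) G i.
  by rewrite [index_enum _]unlock -enumT.
by rewrite !enumE enum_ordSl big_cons big_map.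
Qed.

(* [gamma_upto] for arbitrary radices. *)
Definition upto n (x : 'I_n -> Ord) (i : 'I_n) : Ord :=
  \big[omul/oone]_(m < n | (m <= i)%N) x m.

(* The most significant digit at which [s] and [r] differ has its index in [A]:
   the quotients by [upto n x i] agree exactly when all digits of index > i do. *)
Definition sep_in n (x : 'I_n -> Ord) (A : pred 'I_n) (s r : Ord) : Prop :=
  exists2 i, A i & odiv s (upto n x i) = odiv r (upto n x i) /\
    forall i' : 'I_n, (i' < i)%N -> odiv s (upto n x i') <> odiv r (upto n x i').

Lemma sep_in_sym n (x : 'I_n -> Ord) A s r : sep_in n x A s r -> sep_in n x A r s.
Proof.
by move=> [i Ai [ei mi]]; exists i => //; split=> // i' /mi ne /esym.
Qed.

Lemma prod_gt0 n (x : 'I_n -> Ord) (P : pred 'I_n) :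
  (forall i, ozero < x i) -> ozero < \big[omul/oone]_(i < n | P i) x i.
Proof.
by move=> x0; elim/big_ind: _ => //; [exact: oone_gt0 | exact: omul_gt0].
Qed.

Lemma upto0 n (x : 'I_n.+1 -> Ord) : upto n.+1 x ord0 = x ord0.
Proof. by rewrite /upto big_ord_recl_cond /= big_pred0 ?omul1. Qed.

Lemma uptoS n (x : 'I_n.+1 -> Ord) i :
  upto n.+1 x (lift ord0 i) = omul (x ord0) (upto n (x \o lift ord0) i).
Proof. by rewrite /upto big_ord_recl_cond. Qed.

(** Division by [x ord0] removes digit 0. If the quotients agree, the separating index is 0;
    otherwise it is found among the remaining digits. This drives both inductions below. *)
Lemma sep_inS n (x : 'I_n.+1 -> Ord) (A : pred 'I_n.+1) s r :
  (forall i, ozero < x i) ->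
  sep_in n.+1 x A s r <->
  if odiv s (x ord0) == odiv r (x ord0) then A ord0 : Prop else
  sep_in n (x \o lift ord0) (A \o lift ord0)
    (odiv s (x ord0)) (odiv r (x ord0)).
Proof.
move=> x0.
have E i u : odiv u (upto n.+1 x (lift ord0 i)) =
    odiv (odiv u (x ord0)) (upto n (x \o lift ord0) i).
  by rewrite uptoS odiv_omul// prod_gt0// => m; apply: x0.
have E0 u : odiv u (upto n.+1 x ord0) = odiv u (x ord0) by rewrite upto0.
case: eqP => [e0|ne0]; split.
- case=> i; case: (unliftP ord0 i) => [i'|] -> // _ [_ /(_ ord0)].
  by rewrite !E0 => /(_ isT).
- by exists ord0 => //; rewrite !E0.
- case=> i; case: (unliftP ord0 i) => [i'|] -> Ai; rewrite ?E0 => -[//].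
  rewrite !E => ei mi; exists i' => //; split=> // m mi'.
  by have := mi (lift ord0 m); rewrite !E; apply.
- case=> i Ai [ei mi]; exists (lift ord0 i) => //; rewrite !E; split=> // m.
  case: (unliftP ord0 m) => [m'|] -> mm; last by rewrite !E0.
  by rewrite !E; apply: mi.
Qed.

(** Radix 1 admits only the digit 0, so indices outside [A] carry no information. *)
Definition restrict n (x : 'I_n -> Ord) (A : pred 'I_n) (i : 'I_n) : Ord :=
  if A i then x i else oone.

Lemma eucl_choice b : ozero < b -> exists rem : Ord -> Ord,
  forall r, rem r < b /\ r = oadd (omul b (odiv r b)) (rem r).
Proof.
move=> b0; exists (fun r => s2val (cid2 (odiv_eucl r b b0))) => r.
by case: cid2.
Qed.

(** Induction on the number of digits. Monotonicity is claimed only for pairs separated in [A]: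
    deleting digits may identify or reverse other pairs. *)
Lemma digit_collapse n (x : 'I_n -> Ord) (A : pred 'I_n) :
  (forall i, ozero < x i) ->
  exists c : Ord -> Ord,
    (forall r, r < \big[omul/oone]_(m < n) x m ->
       c r < \big[omul/oone]_(m < n) restrict n x A m) /\
    (forall s r, s < r -> sep_in n x A s r -> c s < c r).
Proof.
elim: n x A => [|n IH] x A x0.
  by exists id; split=> [r|s r _ [[]//]]; rewrite !big_ord0.
have [c [c_lt c_homo]] := IH (x \o lift ord0) (A \o lift ord0) (fun i => x0 _).
have [rem remP] := eucl_choice _ (x0 ord0).
pose q r := odiv r (x ord0).
have q_lt s r : s < r -> q s != q r -> q s < q r.
  by move=> sr ne; rewrite lt_neqAle ne /q odiv_le// ltW.
exists (fun r => if A ord0 then oadd (omul (x ord0) (c (q r))) (rem r)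
                 else c (q r)); split=> [r|s r sr /(sep_inS _ _ _ _ _ x0)].
  rewrite !big_ord_recl => /odiv_lt => /(_ (x0 _))/c_lt; rewrite /restrict.
  case: (A ord0) => lt_cq; last by rewrite mul1o.
  exact: oadd_omul_lt (x0 _) (remP r).1 lt_cq.
have [[rs Es] [rr Er]] := (remP s, remP r).
case: eqP => [eq_q Aq|/eqP ne_q sepq].
  (* Here digit 0 is kept and the quotients agree; cancelling their common multiple of [x ord0]
     turns [s < r] into the inequality of remainders. *)
  rewrite Aq /q eq_q (normal_lt_mono _ (normal_oadd _)).
  by rewrite -(normal_lt_mono _ (normal_oadd (omul (x ord0) (odiv r (x ord0)))))
    -Er -eq_q -Es.
have ltc := c_homo _ _ (q_lt _ _ sr ne_q) sepq.
by case: (A ord0) => //; apply: oadd_omul_lt2 (x0 _) rs ltc.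
Qed.

(** All images have digit 0 at indices outside [A], so two of them can first differ only in [A]. *)
Lemma digit_expand n (x : 'I_n -> Ord) (A : pred 'I_n) :
  (forall i, ozero < x i) ->
  exists e : Ord -> Ord,
    (forall a, a < \big[omul/oone]_(m < n) restrict n x A m ->
       e a < \big[omul/oone]_(m < n) x m) /\
    (forall a b, a < b -> b < \big[omul/oone]_(m < n) restrict n x A m ->
       e a < e b /\ sep_in n x A (e a) (e b)).
Proof.
elim: n x A => [|n IH] x A x0.
  exists id; split=> [r|a b ab]; rewrite !big_ord0// lt_osucc.
  by move=> b0; have := lt_le_trans ab b0; rewrite ltNge ozero_le.
have [e [e_lt e_homo]] := IH (x \o lift ord0) (A \o lift ord0) (fun i => x0 _).
have x00 := x0 ord0.
have [A0|/negbTE A0] := boolP (A ord0); last first.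
  have E a : odiv (omul (x ord0) (e a)) (x ord0) = e a.
    by rewrite -[X in odiv X _]oadd0 odivD.
  (* Multiplication by [x ord0] inserts a zero as least significant digit. *)
  exists (fun a => omul (x ord0) (e a)).
  rewrite !big_ord_recl {1 3}/restrict A0 mul1o; split=> [a /e_lt lt_e|a b ab].
    by rewrite omul_lt.
  move=> /(e_homo _ _ ab)[lt_e sep_e]; split; first by rewrite omul_lt.
  by apply/(sep_inS _ _ _ _ _ x0); rewrite !E lt_eqF.
have [rem remP] := eucl_choice _ x00.
pose q r := odiv r (x ord0).
have E a : odiv (oadd (omul (x ord0) (e (q a))) (rem a)) (x ord0) = e (q a).
  by rewrite odivD// (remP a).1.
exists (fun a => oadd (omul (x ord0) (e (q a))) (rem a)).
rewrite !big_ord_recl {1 3}/restrict A0; split=> [a|a b ab].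
  by move=> /odiv_lt => /(_ x00)/e_lt; apply: oadd_omul_lt (remP a).1.
move=> /odiv_lt => /(_ x00) qb.
have [[ra Ea] [rb Eb]] := (remP a, remP b).
have [eq_q|ne_q] := eqVneq (q a) (q b).
  split; last by apply/(sep_inS _ _ _ _ _ x0); rewrite !E eq_q eqxx.
  rewrite eq_q (normal_lt_mono _ (normal_oadd _)).
  by rewrite -(normal_lt_mono _ (normal_oadd (omul (x ord0) (q b))))
    -Eb -eq_q -Ea.
have lt_q : q a < q b by rewrite lt_neqAle ne_q /q odiv_le// ltW.
have [lt_e sep_e] := e_homo _ _ lt_q qb; split.
  exact: oadd_omul_lt2 ra lt_e.
by apply/(sep_inS _ _ _ _ _ x0); rewrite !E lt_eqF.
Qed.

(** * Heights of points in a well-founded tree *)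

Section Heights.
Variables (d : Order.disp_t) (T : porderType d).
Implicit Types (P Q : set T) (s t : T).

Definition height P t : Ord := tau P oone t.

Lemma tderiv_height P a t : wf_tree P -> P t -> tderiv P a t <-> a <= height P t.
Proof.
move=> wfP Pt; have [th ht] := tauP wfP oone_gt0 Pt.
rewrite !mul1o in th ht; split=> [Pat|/tderiv_anti]; last exact.
by apply: ht; rewrite mul1o.
Qed.

(** Both sides are the largest [a] for which [omul b a] is at most the height of [t]. *)
Lemma tau_odiv P b t : wf_tree P -> ozero < b -> P t ->
  tau P b t = odiv (height P t) b.
Proof.
move=> wfP b0 Pt; have [tb bt] := tauP wfP b0 Pt.
apply/le_anti/andP; split.
  by rewrite le_odiv//; apply/(tderiv_height _ _ _ wfP Pt).
by apply/bt/(tderiv_height _ _ _ wfP Pt); have /andP[] := odiv_bounds (height P t) b b0.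
Qed.

Lemma tderiv_sub P a : tderiv P a `<=` P.
Proof. by have := tderiv_anti (P := P) (ozero_le a); rewrite {2}/tderiv transrec0. Qed.

Lemma tderivS_above P a t : tderiv P (osucc a) t -> exists2 s, tderiv P a s & t < s.
Proof.
rewrite /tderiv transrecS => -[Pat nleaf]; apply: contrapT => ns; apply: nleaf.
by split=> // s Pas ts; apply: ns; exists s.
Qed.

(** A point below a surviving point is never a leaf, so it survives as well. *)
Lemma tderiv_down P a s t : P t -> t < s -> tderiv P a s -> tderiv P a t.
Proof.
move=> Pt ts; elim/(well_founded_ind Ord_wf): a => a.
case: (OrdP a) => [|{}a|{}a lim_a] IH Pas.
- by rewrite /tderiv transrec0.
- move: (Pas); rewrite /tderiv !transrecS => -[Pas' _].
  by split=> [|[_ /(_ s Pas')]//]; apply: IH Pas'; rewrite lt_osucc.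
- move: Pas; rewrite /tderiv !transrec_limit// => Pas _ [b ba <-].
  by apply: (IH b ba); apply: Pas; exists b.
Qed.

Lemma height_lt P s t : wf_tree P -> P s -> P t -> t < s -> height P s < height P t.
Proof.
move=> wfP Ps Pt ts; rewrite -osucc_le; apply/(tderiv_height _ _ _ wfP Pt).
have Phs : tderiv P (height P s) s by apply/(tderiv_height _ _ _ wfP Ps).
rewrite /tderiv transrecS; split; first exact: tderiv_down ts Phs.
by move=> [_ /(_ s Phs)].
Qed.

(** Some [s] above [t] survives to stage [a]. Either its height is [a], or the search continues
    above [s], whose height is smaller than that of [t]. *)
Lemma height_onto P t a : wf_tree P -> P t -> a < height P t ->
  exists s, [/\ P s, t < s & height P s = a].
Proof.
move=> wfP; have [h ht] : exists h, height P t = h by exists (height P t).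
elim/(well_founded_ind Ord_wf): h t ht => h IH t ht Pt ah.
have [s Pas ts] : exists2 s, tderiv P a s & t < s.
  by apply: tderivS_above; apply/(tderiv_height _ _ _ wfP Pt); rewrite osucc_le.
have Ps := tderiv_sub _ _ _ Pas.
have := (tderiv_height _ _ _ wfP Ps).1 Pas.
rewrite le_eqVlt => /predU1P[->|a_lt]; first by exists s.
have [|u [Pu su hu]] := IH (height P s) _ s erefl Ps a_lt.
  by rewrite -ht; apply: height_lt.
by exists u; split=> //; apply: lt_trans su.
Qed.

Lemma rank_le P u : wf_tree P -> rank P <= u <-> forall t, P t -> height P t < u.
Proof.
move=> wfP; have [rank0 rank_min] := rankP wfP; split=> [Pu t Pt|Pu].
  rewrite ltNge; apply/negP => ut.
  have : tderiv P (rank P) t.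
    by apply/(tderiv_height _ _ _ wfP Pt); apply: le_trans ut.
  by rewrite rank0.
apply: rank_min; rewrite -subset0 => t Put.
have Pt := tderiv_sub _ _ _ Put; have := Pu t Pt; rewrite ltNge => /negP; apply.
exact/(tderiv_height _ _ _ wfP Pt).
Qed.

Lemma height_lt_rank P t : wf_tree P -> P t -> height P t < rank P.
Proof. by move=> wfP; apply: (rank_le _ _ wfP).1. Qed.

Lemma rank_onto P a : wf_tree P -> a < rank P -> exists2 t, P t & height P t = a.
Proof.
move=> wfP; rewrite ltNge => /negP na; apply: contrapT => nt; apply: na.
apply/(rank_le _ _ wfP) => t Pt; rewrite ltNge; apply/negP.
rewrite le_eqVlt => /predU1P[ah|/(height_onto _ _ _ wfP Pt)[s [Ps _ hs]]].
  by apply: nt; exists t.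
by apply: nt; exists s.
Qed.

(** Induction on [g t]: were the height of [t] larger, some [s] above [t] would have height [g t],
    which exceeds [g s], against the induction hypothesis. *)
Lemma height_le P (g : T -> Ord) : wf_tree P ->
  (forall s t, P s -> P t -> t < s -> g s < g t) ->
  forall t, P t -> height P t <= g t.
Proof.
move=> wfP g_lt t; have [h gt] : exists h, g t = h by exists (g t).
elim/(well_founded_ind Ord_wf): h t gt => h IH t gt Pt.
rewrite leNgt; apply/negP => /(height_onto _ _ _ wfP Pt)[s [Ps ts hs]].
have gs := g_lt s t Ps Pt ts; rewrite gt in gs.
by have := IH _ gs s erefl Ps; rewrite hs gt leNgt gs.
Qed.

(** * The separation function in terms of digits of heights, and ranks of subtrees *)

Section Separation.
Variables (l : nat) (eps : 'I_l.+1 -> Ord).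

Definition radix (m : 'I_l.+1) : Ord := oexp omega (oexp omega (eps m)).

Lemma radix_gt0 m : ozero < radix m.
Proof. exact: omega_exp_gt0. Qed.

Lemma gamma_onE (A : {set 'I_l.+1}) :
  gamma_on eps A = \big[omul/oone]_(m < l.+1) restrict l.+1 radix (mem A) m.
Proof.
apply: eq_bigr => m _; rewrite /restrict /radix /oindic /=.
case: (m \in A); first by rewrite omul1.
by rewrite omul0 /oexp transrec0.
Qed.

Lemma sepP P s t : wf_tree P -> rank P = gamma eps -> P s -> P t ->
  let u := height P s in let v := height P t in
  let i := sep eps P (s, t) in
  odiv u (upto _ radix i) = odiv v (upto _ radix i) /\
  forall i' : 'I_l.+1, (i' < i)%N ->
    odiv u (upto _ radix i') <> odiv v (upto _ radix i').
Proof.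
move=> wfP rankE Ps Pt u v i.
have tauE x i' : P x -> tau P (gamma_upto eps i') x =
    odiv (height P x) (upto _ radix i').
  by move=> Px; apply: tau_odiv => //; apply: (prod_gt0 _ radix); apply: radix_gt0.
(* The full product is the rank, which exceeds every height; hence the default [ord_max] of the
   minimum is admissible. *)
have max0 x : P x -> tau P (gamma_upto eps ord_max) x = ozero.
  move=> Px; rewrite tauE//; apply: odiv_small; rewrite /upto.
  rewrite (eq_bigl xpredT) => [|m]; last by rewrite /= -ltnS ltn_ord.
  by have := height_lt_rank _ _ wfP Px; rewrite rankE.
rewrite {}/i /sep; case: arg_minnP => [|i /asboolP eq_i min_i].
  by apply/asboolP; rewrite !max0.
split; first by rewrite -!tauE.
move=> i' i'i eq_i'; have /min_i : `[< tau P (gamma_upto eps i') (s, t).1 =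
    tau P (gamma_upto eps i') (s, t).2 >] by apply/asboolP; rewrite /= !tauE.
by rewrite leqNgt i'i.
Qed.

Lemma sep_in_sep P s t (A : pred 'I_l.+1) :
  wf_tree P -> rank P = gamma eps -> P s -> P t ->
  sep_in _ radix A (height P s) (height P t) <-> A (sep eps P (s, t)).
Proof.
move=> wfP rankE Ps Pt; have [eq_i min_i] := sepP _ _ _ wfP rankE Ps Pt.
split=> [[i Ai [eq_i' min_i']]|Ai]; last by exists (sep eps P (s, t)).
suff -> : sep eps P (s, t) = i by [].
apply/val_inj/eqP; rewrite eqn_leq; apply/andP; split; rewrite leqNgt;
  apply/negP; [by move/min_i | by move/min_i'].
Qed.

(** The collapsed height is strictly decreasing on [Q], so it dominates the height in [Q], and its
    values lie below [gamma_on eps A]. *)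
Lemma rank_sep_le P Q (A : {set 'I_l.+1}) :
  wf_tree P -> rank P = gamma eps -> Q `<=` P ->
  (forall st, Lambda2 Q st -> sep eps P st \in A) -> rank Q <= gamma_on eps A.
Proof.
move=> wfP rankE QP sepA; have wfQ := wf_tree_sub QP wfP.
have [c [c_lt c_homo]] := digit_collapse _ radix (mem A) radix_gt0.
apply/(rank_le _ _ wfQ) => t Qt.
have := height_le Q (c \o height P) wfQ _ _ Qt => /(_ _)/le_lt_trans; apply.
  move=> s u Qs Qu us; apply: c_homo.
    by apply: height_lt => //; apply: QP.
  apply: sep_in_sym; apply/(sep_in_sep _ _ _ _ wfP rankE (QP _ Qu) (QP _ Qs)).
  exact: (sepA (u, s)).
rewrite gamma_onE; apply: c_lt; have := height_lt_rank _ _ wfP (QP _ Qt).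
by rewrite rankE.
Qed.

Lemma ex_rank_sep P (A : {set 'I_l.+1}) :
  wf_tree P -> rank P = gamma eps ->
  exists R, [/\ R `<=` P, rank R = gamma_on eps A &
    forall st, Lambda2 R st -> sep eps P st \in A].
Proof.
move=> wfP rankE.
have [e [e_lt e_homo]] := digit_expand _ radix (mem A) radix_gt0.
rewrite -gamma_onE in e_lt e_homo.
pose R := [set t | P t /\ exists2 a, a < gamma_on eps A & height P t = e a].
have RP : R `<=` P by move=> t [].
have wfR := wf_tree_sub RP wfP.
have sepA st : Lambda2 R st -> sep eps P st \in A.
  case: st => s t [/= [Ps [a a_lt ha]] [Pt [b b_lt hb]] st].
  have hts := height_lt _ _ _ wfP Pt Ps st.
  apply/(sep_in_sep _ _ _ (mem A) wfP rankE Ps Pt).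
  rewrite ha hb in hts *; have [ab|ba|ab] := ltgtP a b.
  - by have [] := e_homo _ _ ab b_lt; rewrite ltNge (ltW hts).
  - exact/sep_in_sym/(e_homo b a ba a_lt).2.
  - by rewrite ab ltxx in hts.
(* The upper bound on the rank is the previous lemma; the lower bound compares heights in [R] with
   those in [P]. *)
exists R; split=> //; apply/le_anti/andP; split.
  exact: rank_sep_le wfP rankE RP sepA.
have heightR a t : P t -> height P t = e a -> a < gamma_on eps A ->
    a <= height R t.
  elim/(well_founded_ind Ord_wf): a t => a IH t Pt ha a_lt.
  have Rt : R t by split=> //; exists a.
  (* If the height [b] of [t] in [R] were below [a], a point of [P] above [t] with height [e b]
     would lie in [R] and have height at least [b] there, contradicting strict decrease. *)
  rewrite leNgt; apply/negP => ltRa.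
  have lt_e := (e_homo _ _ ltRa a_lt).1; rewrite -ha in lt_e.
  have [s [Ps ts hs]] := height_onto _ _ _ wfP Pt lt_e.
  have Rs : R s by split=> //; exists (height R t) => //; apply: lt_trans a_lt.
  have := IH _ ltRa s Ps hs (lt_trans ltRa a_lt).
  by rewrite leNgt (height_lt _ _ _ wfR Rs Rt ts).
(* Otherwise a point of [P] with height [e (rank R)] lies in [R], and its height there reaches the
   rank of [R]. *)
rewrite leNgt; apply/negP => rank_lt.
have [|t Pt ht] := rank_onto P (e (rank R)) wfP.
  by rewrite rankE; apply: e_lt.
have Rt : R t by split=> //; exists (rank R).
by have := heightR _ _ Pt ht rank_lt; rewrite leNgt (height_lt_rank _ _ wfR Rt).
Qed.

End Separation.
End Heights.

Theorem theorem1p3 (k l : nat) :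
  (forall (d : Order.disp_t) (T : porderType d)
      (eps : 'I_l.+1 -> Ord) (P Q : set T)
      (f : T * T -> 'I_k.+1) (F : 'I_l.+1 -> 'I_k.+1) (j : 'I_k.+1),
    (forall m n : 'I_l.+1, (m <= n)%N -> eps n <= eps m) ->
    is_tree P -> wf_tree P -> rank P = gamma eps ->
    Q `<=` P -> rank Q = rank P ->
    (forall st : T * T, Lambda2 Q st ->
       sep eps Q st = sep eps P st /\ F (sep eps Q st) = f st) ->
    let A := [set i : 'I_l.+1 | F i == j]%SET in
    exists R : set T,
      [/\ R `<=` P, rank R = gamma_on eps A &
          forall st : T * T, Lambda2 R st -> f st = j])
  /\
  (forall (d : Order.disp_t) (T : porderType d)
      (eps : 'I_l.+1 -> Ord) (P : set T)
      (f : T * T -> 'I_k.+1) (F : 'I_l.+1 -> 'I_k.+1) (j : 'I_k.+1),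
    (forall m n : 'I_l.+1, (m <= n)%N -> eps n <= eps m) ->
    is_tree P -> wf_tree P -> rank P = gamma eps ->
    (forall st : T * T, Lambda2 P st -> f st = F (sep eps P st)) ->
    let A := [set i : 'I_l.+1 | F i == j]%SET in
    forall Q : set T, Q `<=` P ->
      (forall st : T * T, Lambda2 Q st -> f st = j) ->
      rank Q <= gamma_on eps A).
Proof.
split=> d T eps P.
  move=> Q f F j _ _ wfP rankP QP rankQ fE A.
  have [|R [RQ rankR sepA]] := ex_rank_sep _ _ _ eps Q A (wf_tree_sub QP wfP).
    by rewrite rankQ.
  exists R; split=> // [t /RQ/QP//|st R_st].
  have [|_ <-] := fE st; first by case: R_st => /RQ ? /RQ; split.
  by apply/eqP; have := sepA _ R_st; rewrite inE.
move=> f F j _ _ wfP rankP fE A Q QP fj.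
(* Constancy of [f] on pairs of [Q] says precisely that their separation indices lie in [A]. *)
apply: (rank_sep_le _ _ _ eps _ _ A wfP rankP QP) => st Q_st.
rewrite inE -fE ?fj//; case: Q_st => /QP ? /QP; by split.
Qed.
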